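(* Let $K\subseteq\mathbb{R}^m$ be a closed, convex, pointed and solid cone, $e\in\operatorname{int}K$, let $f^1,\dots,f^p:\mathbb{R}^n\to\mathbb{R}^m$ be continuously differentiable, and let $F(x)=\{f^1(x),\dots,f^p(x)\}$ for $x\in\mathbb{R}^n$. Suppose that the descent method (Algorithm 1, described in the context), for some $x_0\in\mathbb{R}^n$ and $\beta,\nu\in(0,1)$, generates an infinite sequence $\{x_k\}_{k\ge 0}$ for which $\bar x\in\mathbb{R}^n$ is an accumulation point. Furthermore, assume that $\bar x$ is regular for $F$. Then $\bar x$ is a stationary point of the set optimization problem of minimizing $F$ over $\mathbb{R}^n$ with respect to the lower set less relation. If in addition $|P_{\bar x}|=1$, then $\bar x$ is a strongly stationary point of this problem.
   Context: Notation: $[k]=\{1,\dots,k\}$. A cone $K\subseteq\mathbb{R}^m$ is a nonempty set with $ty\in K$ for all $y\in K$, $t\ge 0$; it is convex if $K+K=K$, pointed if $K\cap(-K)=\{0\}$, solid if $\operatorname{int}K\ne\emptyset$. Dual cone: $K^*=\{v\in\mathbb{R}^m\mid v^\top y\ge 0\ \forall y\in K\}$. Order: $y\preceq z$ iff $z-y\in K$. For differentiable $f:\mathbb{R}^n\to\mathbb{R}^m$, $\nabla f(x)\in\mathbb{R}^{n\times m}$ is the transpose of the Jacobian, so $\nabla f(x)^\top u\in\mathbb{R}^m$ is the directional derivative along $u\in\mathbb{R}^n$. $\|\cdot\|$ is the Euclidean norm. Gerstewitz functional: $\psi_e:\mathbb{R}^m\to\mathbb{R}$, $\psi_e(y)=\min\{t\in\mathbb{R}\mid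 te\in y+K\}$. For a nonempty $A\subseteq\mathbb{R}^m$: $\operatorname{Min}(A,K)=\{y\in A\mid (y-K)\cap A=\{y\}\}$ and $\operatorname{WMin}(A,K)=\{y\in A\mid (y-\operatorname{int}K)\cap A=\emptyset\}$. Index sets: $I(x)=\{i\in[p]\mid f^i(x)\in\operatorname{Min}(F(x),K)\}$; for $v\in\mathbb{R}^m$, $I_v(x)=\{i\in I(x)\mid f^i(x)=v\}$; $\omega(x)=|\operatorname{Min}(F(x),K)|$. For each $x$ an enumeration $v^x_1,\dots,v^x_{\omega(x)}$ of $\operatorname{Min}(F(x),K)$ (as distinct vectors) is fixed, and the partition set of $x$ is $P_x=\prod_{j=1}^{\omega(x)}I_{v^x_j}(x)$; elements are written $a=(a_1,\dots,a_{\omega(x)})$. Algorithm 1 (Descent method). Step 0: choose $x_0\in\mathbb{R}^n$, $\beta,\nu\in(0,1)$; set $k:=0$. Step 1: compute $\operatorname{Min}(F(x_k),K)$, $P_k:=P_{x_k}$, $\omega_k:=\omega(x_k)$. Step 2: find $(a_k,u_k)\in\operatorname{argmin}_{(a,u)\in P_k\times\mathbb{R}^n}\ \max_{j\in[\omega_k]}\psi_e(\nabla f^{a_j}(x_k)^\top u)+\frac12\|u\|^2$; write $a_k=(a_{k,1},\dots,a_{k,\omega_k})$. Step 3: if $u_k=0$, stop; otherwise go to Step 4. Step 4: set $t_k:=\max\{\nu^q\mid q\in\mathbb{N}\cup\{0\},\ \forall j\in[\omega_k]: f^{a_{k,j}}(x_k+\nu^q u_k)\preceq f^{a_{k,j}}(x_k)+\beta\nu^q\nabla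 f^{a_{k,j}}(x_k)^\top u_k\}$. Step 5: set $x_{k+1}:=x_k+t_ku_k$, $k:=k+1$, and go to Step 1. Regularity: $\bar x$ is a regular point of $F$ if (i) $\operatorname{Min}(F(\bar x),K)=\operatorname{WMin}(F(\bar x),K)$ and (ii) $\omega$ is constant in a neighborhood of $\bar x$. Stationarity: with $\bar\omega=\omega(\bar x)$, $\bar x$ is stationary with respect to a nonempty set $Q\subseteq P_{\bar x}$ if for every $a\in Q$ there exist $\mu_1,\dots,\mu_{\bar\omega}\in K^*$, not all zero, with $\sum_{j=1}^{\bar\omega}\nabla f^{a_j}(\bar x)\mu_j=0$. It is a stationary point if it is stationary with respect to some nonempty $Q\subseteq P_{\bar x}$, and a strongly stationary point if it is stationary with respect to $Q=P_{\bar x}$. *)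

(* Defs.v *)
From mathcomp Require Import all_boot all_order all_algebra finmap.
From mathcomp Require Import all_classical all_reals all_analysis.

Set Implicit Arguments.
Unset Strict Implicit.
Unset Printing Implicit Defensive.

Import Order.TTheory GRing.Theory Num.Theory.
Import numFieldNormedType.Exports.

Local Open Scope classical_set_scope.
Local Open Scope ring_scope.

(* Vectors are rows.  The topology of 'rV[R]_n comes from the sup norm, which
   is equivalent to the Euclidean one; the Euclidean norm itself is [enorm]. *)

Section Extrema.
Context {R : realType}.

Definition is_minimum (A : set R) (t : R) := A t /\ lbound A t.
Definition is_maximum (A : set R) (t : R) := A t /\ ubound A t.

(* Junk value 0 when the extremum is not attained. *)
Definition minimum (A : set R) : R := xget 0 [set t | is_minimum A t].
Definition maximum (A : set R) : R := xget 0 [set t | is_maximum A t].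

End Extrema.

Section Euclidean.
Context {R : realType} {n : nat}.

Definition dot (u v : 'rV[R]_n) : R := \sum_i u ord0 i * v ord0 i.
Definition enorm (u : 'rV[R]_n) : R := Num.sqrt (dot u u).

End Euclidean.

Section Cones.
Context {R : realType} {m : nat}.
Implicit Types (K A : set 'rV[R]_m) (y z e : 'rV[R]_m).

Definition is_cone K :=
  K !=set0 /\ forall y (t : R), K y -> 0 <= t -> K (t *: y).
Definition convex_cone K := [set y + z | y in K & z in K] = K.
Definition pointed_cone K := K `&` [set - y | y in K] = [set 0].
Definition solid_cone K := interior K !=set0.

Definition dual_cone K : set 'rV[R]_m :=
  [set v | forall y, K y -> 0 <= dot v y].

Definition cone_le K y z := K (z - y).

Definition gerstewitz K e y : R :=
  minimum [set t | [set y + k | k in K] (t *: e)].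

Definition Min A K : set 'rV[R]_m :=
  [set y | A y /\ [set y - k | k in K] `&` A = [set y]].
Definition WMin A K : set 'rV[R]_m :=
  [set y | A y /\ [set y - k | k in interior K] `&` A = set0].

End Cones.

(* [jacobian f x], written ['J f x], acts on rows from the right: the
   directional derivative of f at x along u is [u *m 'J f x].  It is thus the
   n x m matrix usually denoted by nabla f(x). *)
Definition continuously_differentiable (R : realType) (n m : nat)
    (f : 'rV[R]_n -> 'rV[R]_m) :=
  (forall x, differentiable f x) /\ continuous (jacobian f).

Section SetOptimization.
Context {R : realType} {n m p : nat}.
Variables (K : set 'rV[R]_m) (f : 'I_p -> 'rV[R]_n -> 'rV[R]_m).

Definition setF (x : 'rV[R]_n) : set 'rV[R]_m := range (fun i => f i x).

Definition active (x : 'rV[R]_n) : {set 'I_p} :=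
  finset (fun i => `[< Min (setF x) K (f i x) >]).
Definition active_at (y : 'rV[R]_m) (x : 'rV[R]_n) : {set 'I_p} :=
  finset (fun i => (i \in active x) && (f i x == y)).

Definition omega (x : 'rV[R]_n) : nat := #|` fset_set (Min (setF x) K)|%fset.

Definition regular (x : 'rV[R]_n) :=
  Min (setF x) K = WMin (setF x) K /\
  (\forall y \near x, omega y = omega x).

Definition is_enumeration (v : forall x : 'rV[R]_n, 'I_(omega x) -> 'rV[R]_m) :=
  forall x, set_bij [set: 'I_(omega x)] (Min (setF x) K) (v x).

(* The enumeration of the minimal elements fixed at every point. *)
Variable v : forall x : 'rV[R]_n, 'I_(omega x) -> 'rV[R]_m.

Definition partition_set (x : 'rV[R]_n) : {set {ffun 'I_(omega x) -> 'I_p}} :=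
  finset (fun a : {ffun 'I_(omega x) -> 'I_p} =>
            [forall j, a j \in active_at (v j) x]).

Definition stationary_wrt (x : 'rV[R]_n)
    (Q : {set {ffun 'I_(omega x) -> 'I_p}}) :=
  [/\ Q != finset.set0, Q \subset partition_set x &
      forall a, a \in Q -> exists mu : 'I_(omega x) -> 'rV[R]_m,
        [/\ forall j, dual_cone K (mu j),
            exists j, mu j != 0 &
            \sum_j mu j *m ('J (f (a j)) x)^T = 0]].

Definition stationary (x : 'rV[R]_n) :=
  exists Q : {set {ffun 'I_(omega x) -> 'I_p}}, stationary_wrt Q.
Definition strongly_stationary (x : 'rV[R]_n) :=
  stationary_wrt (partition_set x).

Section DescentMethod.
Variable e : 'rV[R]_m.

Definition descent_objective (x : 'rV[R]_n)
    (a : {ffun 'I_(omega x) -> 'I_p}) (u : 'rV[R]_n) : R :=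
  maximum (range (fun j => gerstewitz K e (u *m 'J (f (a j)) x)))
  + 2^-1 * enorm u ^+ 2.

Definition descent_argmin (x : 'rV[R]_n)
    (a : {ffun 'I_(omega x) -> 'I_p}) (u : 'rV[R]_n) :=
  a \in partition_set x /\
  forall (a' : {ffun 'I_(omega x) -> 'I_p}) (u' : 'rV[R]_n),
    a' \in partition_set x ->
    descent_objective a u <= descent_objective a' u'.

Definition sufficient_decrease (beta : R) (x : 'rV[R]_n)
    (a : {ffun 'I_(omega x) -> 'I_p}) (u : 'rV[R]_n) (t : R) :=
  forall j, cone_le K (f (a j) (x + t *: u))
                      (f (a j) x + (beta * t) *: (u *m 'J (f (a j)) x)).

(* [x] is the sequence of iterates of a run that starts at [x0] and never
   meets the stopping test. *)
Definition descent_sequence (x0 : 'rV[R]_n) (beta nu : R)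
    (x : nat -> 'rV[R]_n) :=
  x 0%N = x0 /\
  exists (a : forall k, {ffun 'I_(omega (x k)) -> 'I_p})
         (u : nat -> 'rV[R]_n) (t : nat -> R),
  forall k,
    [/\ descent_argmin (a k) (u k),
        u k != 0,
        is_maximum [set nu ^+ q | q in
            [set q | sufficient_decrease beta (a k) (u k) (nu ^+ q)]] (t k) &
        x k.+1 = x k + t k *: u k].

End DescentMethod.
End SetOptimization.

(* Main.v *)
Require Import Defs.
From mathcomp Require Import all_boot all_order all_algebra finmap.
From mathcomp Require Import all_classical all_reals all_analysis.
From mathcomp Require Import ring lra.
Import Order.TTheory GRing.Theory Num.Theory.
Import numFieldNormedType.Exports.
Local Open Scope classical_set_scope.
Local Open Scope ring_scope.

Set Implicit Arguments.
Unset Strict Implicit.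

(* The scalarization [g x = min_i psi_e (f^i x)] satisfies
   [g x_(k+1) <= g x_k - beta / 2 * t_k * |u_k|^2], because the minimum
   defining [g x_k] is attained at a minimal element of [F x_k].  As [g] is
   continuous and decreases along the run, [t_k |u_k|^2] gets arbitrarily small
   while [x_k] is close to the cluster point [xbar].  If for every [a] in
   [P_xbar] some [w] made all [psi_e (grad f^(a_j) xbar^T w)] negative, then
   backtracking from points near [xbar] would keep [t |u|^2] bounded away from
   0; here the local constancy of [omega] enters, to match each index tuple used
   at [x_k] with one in [P_xbar].  Hence some [a] in [P_xbar] admits no common
   descent direction, and Gordan's alternative turns this into multipliers. *)

(** * Entrywise estimates for the sup norm of matrices *)

Section MatrixNorm.
Context {R : realType}.

Lemma le_coord_norm m n (A : 'M[R]_(m, n)) i j : `|A i j| <= `|A|.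
Proof.
rewrite [leRHS]mx_normrE.
exact: (le_bigmax _ (fun ij : 'I_m * 'I_n => `|A ij.1 ij.2|) (i, j)).
Qed.

Lemma norm_le_coord m n (A : 'M[R]_(m, n)) (c : R) :
  0 <= c -> (forall i j, `|A i j| <= c) -> `|A| <= c.
Proof.
by move=> c0 Ac; rewrite [leLHS]mx_normrE; apply: bigmax_le => // -[i j] _.
Qed.

Lemma norm_mulmx_le m n p (A : 'M[R]_(m, n)) (B : 'M[R]_(n, p)) :
  `|A *m B| <= n%:R * `|A| * `|B|.
Proof.
apply: norm_le_coord => [|i j]; first by rewrite !mulr_ge0.
rewrite mxE (le_trans (ler_norm_sum _ _ _))//.
rewrite (le_trans (ler_sum _ (_ : forall k, _ -> _ <= `|A| * `|B|)))//.
  by move=> k _; rewrite normrM ler_pM// le_coord_norm.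
by rewrite sumr_const card_ord -mulrA mulr_natl.
Qed.

End MatrixNorm.

(** * The Euclidean inner product and its comparison with the sup norm *)

Section DotProduct.
Context {R : realType}.

Lemma dotC n (u w : 'rV[R]_n) : dot u w = dot w u.
Proof. by apply: eq_bigr => i _; rewrite mulrC. Qed.

Lemma dot_mulmx n (u w : 'rV[R]_n) : dot u w = (u *m w^T) ord0 ord0.
Proof. by rewrite mxE; apply: eq_bigr => i _; rewrite mxE. Qed.

Lemma dotN n (u w : 'rV[R]_n) : dot u (- w) = - dot u w.
Proof. by rewrite /dot -sumrN; apply: eq_bigr => i _; rewrite mxE mulrN. Qed.

Lemma dotB n (u w z : 'rV[R]_n) : dot u (w - z) = dot u w - dot u z.
Proof. by rewrite /dot -sumrB; apply: eq_bigr => i _; rewrite !mxE mulrBr. Qed.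

Lemma dot0 n (u : 'rV[R]_n) : dot u 0 = 0.
Proof. by apply: big1 => i _; rewrite mxE mulr0. Qed.

Lemma dot_ge0 n (u : 'rV[R]_n) : 0 <= dot u u.
Proof. by apply: sumr_ge0 => i _; rewrite -expr2 sqr_ge0. Qed.

Lemma enorm2E n (u : 'rV[R]_n) : enorm u ^+ 2 = dot u u.
Proof. by rewrite sqr_sqrtr// dot_ge0. Qed.

Lemma enorm2Z n (s : R) (u : 'rV[R]_n) :
  enorm (s *: u) ^+ 2 = s ^+ 2 * enorm u ^+ 2.
Proof.
rewrite !enorm2E /dot mulr_sumr; apply: eq_bigr => i _.
by rewrite !mxE; ring.
Qed.

Lemma norm2_le_enorm2 n (u : 'rV[R]_n) : `|u| ^+ 2 <= enorm u ^+ 2.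
Proof.
rewrite lerXn2r// ?nnegrE ?sqrtr_ge0//.
apply: norm_le_coord => [|i j]; first exact: sqrtr_ge0.
rewrite -sqrtr_sqr ler_sqrt ?dot_ge0// (ord1 i) /dot (bigD1 j)//= expr2 lerDl.
by apply: sumr_ge0 => k _; rewrite -expr2 sqr_ge0.
Qed.

Lemma norm2_le_dot n (u : 'rV[R]_n) : `|u| ^+ 2 <= dot u u.
Proof. by rewrite -enorm2E norm2_le_enorm2. Qed.

Lemma dot_gt0 n (u : 'rV[R]_n) : u != 0 -> 0 < dot u u.
Proof.
by move=> u0; rewrite (lt_le_trans _ (norm2_le_dot u))// exprn_gt0// normr_gt0.
Qed.

Lemma dot_shift n (a b : 'rV[R]_n) (s : R) :
  dot (a + s *: b) (a + s *: b) = dot a a + 2 * s * dot a b + s ^+ 2 * dot b b.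
Proof.
rewrite /dot !mulr_sumr -!big_split /=; apply: eq_bigr => i _.
by rewrite !mxE; ring.
Qed.

End DotProduct.

(** * Closures in normed spaces and separation from a convex cone *)

Lemma closure_approxP {R : realType} {V : normedModType R} (A : set V) (z : V) :
  closure A z <-> forall d : R, 0 < d -> exists2 y, A y & `|z - y| < d.
Proof.
split=> [zA d d0|zA B /nbhs_ballP[d /= d0 dB]].
  have [y [Ay]] := zA _ (nbhsx_ballx z d d0).
  by rewrite -ball_normE; exists y.
have [y Ay zy] := zA d d0; exists y; split=> //.
by apply: dB; rewrite -ball_normE.
Qed.

Lemma closed_approx {R : realType} {V : normedModType R} (A : set V) (z : V) :
  closed A -> (forall d : R, 0 < d -> exists2 y, A y & `|z - y| < d) -> A z.
Proof. by move=> A_closed /closure_approxP; exact: A_closed. Qed.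

Section Separation.
Context {R : realType}.

(** After division by [s], letting [s] tend to 0 leaves [0 <= 2 * b]. This extracts the first-order
    conditions satisfied by a projection. *)
Lemma ge0_of_small_quadratic (b c : R) :
  (forall s, 0 < s <= 1 -> 0 <= 2 * s * b + s ^+ 2 * c) -> 0 <= b.
Proof.
move=> bc; rewrite leNgt; apply/negP => b0.
have c1 : 0 < `|c| + 1 by rewrite ltr_wpDl.
pose s := Num.min 1 (- b / (`|c| + 1)).
have s0 : 0 < s by rewrite lt_min ltr01 divr_gt0// oppr_gt0.
have s1 : s <= 1 by rewrite ge_min lexx.
have sb : s * (`|c| + 1) <= - b by rewrite -ler_pdivlMr// ge_min lexx orbT.
have := bc s; rewrite s0 s1 => /(_ isT).
rewrite (_ : _ + _ = s * (2 * b + s * c)); last by ring.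
rewrite pmulr_rge0// leNgt => /negP; apply.
have : s * c <= s * (`|c| + 1).
  by rewrite ler_pM2l// (le_trans (ler_norm c))// lerDl.
by lra.
Qed.

Lemma continuous_dist2 n (p : 'rV[R]_n) :
  continuous (fun y : 'rV[R]_n => dot (y - p) (y - p)).
Proof.
rewrite /dot; elim: (index_enum _) => [|i r IHr] y.
  under [X in continuous_at _ X]eq_fun do rewrite big_nil.
  exact: cst_continuous.
have cy : continuous_at y (fun z : 'rV[R]_n => (z - p) ord0 i).
  apply: (@continuous_comp _ _ _ (fun z : 'rV[R]_n => z - p)
      (fun z : 'rV[R]_n => z ord0 i)).
    by apply: continuousB; [exact: cvg_id | exact: cst_continuous].
  exact: coord_continuous.
under [X in continuous_at _ X]eq_fun do rewrite big_cons.
apply: cvgD; [exact: (nbhs_filter (y : 'rV[R]_n)) | | exact: IHr].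
exact: (continuousM cy cy).
Qed.

(* The separating functional is [c - p], with [c] the projection of [p] onto
   the closure of [D]. *)
Lemma convex_cone_separation n (D : set 'rV[R]_n) (p : 'rV[R]_n) (r : R) :
    D 0 -> (forall y z, D y -> D z -> D (y + z)) ->
    (forall y (t : R), D y -> 0 <= t -> D (t *: y)) ->
    0 < r -> (forall y, D y -> r <= `|p - y|) ->
  exists2 mu : 'rV[R]_n, forall y, D y -> 0 <= dot mu y & dot mu p < 0.
Proof.
move=> D0 DD DZ r0 Dr.
have FD y d : closure D y -> D d -> closure D (y + d).
  move=> /closure_approxP Fy Dd; apply/closure_approxP => eps eps0.
  have [z Dz yz] := Fy eps eps0; exists (z + d); first exact: DD.
  by rewrite opprD addrACA subrr addr0.
have FZ y (t : R) : closure D y -> 0 <= t <= 1 -> closure D (t *: y).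
  move=> /closure_approxP Fy /andP[t0 t1]; apply/closure_approxP => eps eps0.
  have [z Dz yz] := Fy eps eps0; exists (t *: z); first exact: DZ.
  rewrite -scalerBr normrZ ger0_norm// (le_lt_trans _ yz)//.
  by rewrite ler_piMl.
pose f (y : 'rV[R]_n) := dot (y - p) (y - p).
(* Points of the closure no farther from [p] than 0 form a compact set, on which the distance to [p]
   attains its minimum. *)
pose A : set 'rV[R]_n := closure D `&` [set y | f y <= f 0].
have A0 : A 0 by split => /=; first exact: subset_closure.
have A_compact : compact A.
  apply: bounded_closed_compact.
    exists (`|p| + Num.sqrt (f 0)); split; first by rewrite num_real.
    move=> M ltM y [_ /= fy]; apply: (le_trans _ (ltW ltM)).
    rewrite -(subrK p y) (le_trans (ler_normD _ _))// addrC lerD2l.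
    rewrite -[leLHS]ger0_norm// -sqrtr_sqr ler_sqrt ?dot_ge0//.
    exact: le_trans (norm2_le_dot _) fy.
  apply: closedI; first exact: closed_closure.
  apply: (@preimage_closed _ _ f [set z | z <= f 0]); last exact: closed_le.
  by move=> y _; exact: continuous_dist2.
have [c /set_mem[Fc _] cmin] :
    exists2 c, c \in A & forall y, y \in A -> f c <= f y.
  apply: compact_EVT_min => //; first by exists 0.
  by apply: continuous_subspaceT; exact: continuous_dist2.
have {}cmin y : closure D y -> f c <= f y.
  move=> Fy; have [f0|f0] := leP (f y) (f 0).
    by apply: cmin; apply/mem_set.
  by rewrite (le_trans _ (ltW f0))//; apply: cmin; exact/mem_set.
have cp0 : c - p != 0.
  apply/eqP => cp; have /closure_approxP/(_ _ r0)[y /Dr] := Fc.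
  by rewrite -[c](subrK p) cp add0r => /le_lt_trans h/h; rewrite ltxx.
exists (c - p) => [y Dy|].
  apply: (@ge0_of_small_quadratic _ (dot y y)) => s /andP[s0 _].
  have := cmin _ (FD _ _ Fc (DZ _ _ Dy (ltW s0))).
  by rewrite /f addrAC dot_shift -addrA lerDl.
(* Moving from [c] towards 0 stays in the closure, so minimality of [c] bounds this product. *)
have cc : dot (c - p) c <= 0.
  rewrite -oppr_ge0 -dotN.
  apply: (@ge0_of_small_quadratic _ (dot (- c) (- c))) => s /andP[s0 s1].
  have s01 : 0 <= 1 - s <= 1 by rewrite subr_ge0 s1 lerBlDr lerDl ltW.
  have := cmin _ (FZ _ _ Fc s01).
  rewrite /f (_ : _ *: c - p = c - p + s *: (- c)).
    by rewrite dot_shift -addrA lerDl.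
  by apply/matrixP => i j; rewrite !mxE; ring.
rewrite (_ : dot _ p = dot (c - p) c - dot (c - p) (c - p)).
  by rewrite ltrBlDr (le_lt_trans cc)// add0r dot_gt0.
by rewrite dotB; ring.
Qed.

(** Elements of a product of [N] spaces are coded as flattened matrices; a functional on them thus
    splits into one multiplier per row. *)
Lemma dot_mxvec N m (mu : 'rV[R]_(N * m)) (B : 'M[R]_(N, m)) :
  dot mu (mxvec B) = \sum_j dot (row j (vec_mx mu)) (row j B).
Proof.
rewrite /dot (reindex _ (curry_mxvec_bij _ _)) /= pair_bigA /=.
by apply: eq_bigr => -[i j] _ /=; rewrite mxvecE !mxE.
Qed.

Lemma row_mxvec_norm_le N m (B : 'M[R]_(N, m)) j : `|row j B| <= `|mxvec B|.
Proof.
apply: norm_le_coord => // i k.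
by rewrite mxE -[B j k]mxvecE le_coord_norm.
Qed.

End Separation.

(** * Uniform first-order expansion near a point *)

Section StrictDifferentiability.
Context {R : realType} {n m : nat}.

Lemma is_derive_line (f : 'rV[R]_n -> 'rV[R]_m) (x d : 'rV[R]_n) (t : R) j :
    differentiable f (x + t *: d) ->
  is_derive t 1 (fun s : R => f (x + s *: d) ord0 j)
    ((d *m 'J f (x + t *: d)) ord0 j).
Proof.
move=> df; set a := x + t *: d.
have cf : h^-1 *: (f (h *: d + a) - f a) @[h --> (0 : R)^'] --> d *m 'J f a.
  rewrite -deriveEjacobian//. exact: (diff_derivable df).
have cg : h^-1 *: (f (x + (h *: 1 + t) *: d) ord0 j - f a ord0 j)
    @[h --> (0 : R)^'] --> (d *m 'J f a) ord0 j.
  have := @cvg_comp _ _ _ _ _ _ _ _ cf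
    (@coord_continuous R 1 m ord0 j (d *m 'J f a)).
  apply: cvg_trans; apply: near_eq_cvg; near=> h.
  have E : h *: (1 : R) = h by rewrite /GRing.scale /= mulr1.
  have E2 : (h^-1 *: (f (h *: d + a) - f a)) ord0 j =
         h^-1 * (f (h *: d + a) ord0 j - f a ord0 j) by rewrite !mxE.
  have E3 : h *: d + a = x + (h + t) *: d by rewrite /a scalerDl addrCA.
  rewrite E -E3.
  exact: E2.
apply: DeriveDef; first by apply/cvg_ex; eexists; exact: cg.
exact: cvg_lim cg.
Unshelve. all: by end_near. Qed.

(** The mean value theorem along the segment, one coordinate at a time, bounds the remainder by a
    difference of Jacobians near [a]. Both endpoints may vary, as the iterates do. *)
Lemma continuously_differentiable_strict (f : 'rV[R]_n -> 'rV[R]_m)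
    (a : 'rV[R]_n) (eps : R) :
    continuously_differentiable f -> 0 < eps ->
  exists2 rho : R, 0 < rho &
    forall x d : 'rV[R]_n, `|x - a| < rho -> `|x + d - a| < rho ->
      `|f (x + d) - f x - d *m 'J f x| <= eps * `|d|.
Proof.
move=> [df cJ] eps0.
(* Two Jacobian differences and the factor [n] of [norm_mulmx_le] cost [2 * n]; the added 1 keeps
   the denominator positive. *)
pose eps' : R := eps / (n%:R * 2 + 1).
have n1 : 0 < n%:R * 2 + 1 :> R by rewrite ltr_wpDl// mulr_ge0.
have eps'0 : 0 < eps' by rewrite divr_gt0.
have /cvgrPdist_le/(_ _ eps'0)/nbhs_ballP[rho /= rho0 Jrho] := cJ a.
have {}Jrho y : `|y - a| < rho -> `|'J f y - 'J f a| <= eps'.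
  by move=> ya; rewrite distrC; apply: Jrho; rewrite -ball_normE /= distrC.
exists rho => // x d xa xda; apply: norm_le_coord => [|i j].
  by rewrite mulr_ge0// ltW.
rewrite (ord1 i) {i}.
pose g (s : R) : R := f (x + s *: d) ord0 j.
pose dg (s : R) : R := (d *m 'J f (x + s *: d)) ord0 j.
have gd (s : R) : is_derive s (1 : R) (g : R -> R) (dg s) by exact: is_derive_line.
have [c] : exists2 c, c \in `]0, 1[ & g 1 - g 0 = dg c * (1 - 0).
  apply: MVT => //; apply: continuous_subspaceT => s.
  by apply: differentiable_continuous; apply/derivable1_diffP; case: (gd s).
rewrite in_itv /= => /andP[c0 c1] gE.
have ca : `|x + c *: d - a| < rho.
  have -> : x + c *: d - a = (1 - c) *: (x - a) + c *: (x + d - a).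
    by apply/matrixP => i k; rewrite !mxE; ring.
  rewrite (le_lt_trans (ler_normD _ _))// !normrZ !gtr0_norm ?subr_gt0//.
  have -> : rho = (1 - c) * rho + c * rho by ring.
  by rewrite ltrD// ltr_pM2l// subr_gt0.
have -> : (f (x + d) - f x - d *m 'J f x) ord0 j =
    (d *m ('J f (x + c *: d) - 'J f x)) ord0 j.
  transitivity (g 1 - g 0 - (d *m 'J f x) ord0 j).
    by rewrite /g scale1r scale0r addr0 [LHS]mxE [X in X + _]mxE [X in _ + X]mxE
      [X in _ + X + _]mxE.
  by rewrite gE subr0 mulr1 mulmxBr [RHS]mxE [X in _ = _ + X]mxE.
rewrite (le_trans (le_coord_norm _ _ _))// (le_trans (norm_mulmx_le _ _))//.
have JJ : `|'J f (x + c *: d) - 'J f x| <= 2 * eps'.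
  rewrite -(subrKA ('J f a)) (le_trans (ler_normD _ _))//.
  have -> : 2 * eps' = eps' + eps' by ring.
  by apply: lerD; [exact: Jrho | rewrite distrC; exact: Jrho].
rewrite (le_trans (ler_wpM2l _ JJ)) ?mulr_ge0//.
have -> : n%:R * `|d| * (2 * eps') = (n%:R * 2 * eps') * `|d| by ring.
rewrite ler_wpM2r// /eps' mulrCA ler_piMr ?(ltW eps0)//.
by rewrite ler_pdivrMr// mul1r lerDl.
Qed.

End StrictDifferentiability.

(** * Uniform constants over finite families, backtracking and neighborhoods *)

Section FiniteBounds.
Context {R : realType} {I : finType}.

Lemma finite_negative_bound (A : {set I}) (h : I -> R) :
    (forall i, i \in A -> h i < 0) ->
  exists2 eta : R, 0 < eta & forall i, i \in A -> h i <= - eta.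
Proof.
(* The default 1 of the minimum is the witness when [A] is empty. *)
move=> hA; exists (\big[Num.min/1]_(i in A) - h i).
  by apply: lt_bigmin => // i iA; rewrite oppr_gt0 hA.
by move=> i iA; rewrite lerNr; apply: bigmin_le_cond.
Qed.

Lemma finite_radius (P : I -> R -> Prop) :
    (forall i r r', r' <= r -> P i r -> P i r') ->
    (forall i, exists2 r, 0 < r & P i r) ->
  exists2 r : R, 0 < r & forall i, P i r.
Proof.
move=> P_mono Pr.
have /choice[r rP] : forall i, exists r, 0 < r /\ P i r.
  by move=> i; have [r r0 Pir] := Pr i; exists r.
exists (\big[Num.min/1]_i r i).
  by apply: lt_bigmin => // i _; exact: (rP i).1.
by move=> i; apply: P_mono (rP i).2; exact: bigmin_le_cond.
Qed.

End FiniteBounds.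

(** With exponent 0 the full step is taken. Otherwise [t / nu] is an earlier, larger trial step, and
    maximality of [t] means that it was rejected. *)
Lemma backtracking_fails (R : realType) (P : R -> Prop) (nu t : R) :
    0 < nu -> nu < 1 ->
    is_maximum [set nu ^+ q | q in [set q | P (nu ^+ q)]] t ->
  P t /\ (t = 1 \/ 0 < t /\ ~ P (t / nu)).
Proof.
move=> nu0 nu1 [[[|q] /= Pq <-] tmax]; first by split=> //; left; rewrite expr0.
split=> //; right; split; first exact: exprn_gt0.
have -> : nu ^+ q.+1 / nu = nu ^+ q by rewrite exprSr mulfK// gt_eqF.
move=> Pq'; have /tmax : [set nu ^+ q | q in [set q | P (nu ^+ q)]] (nu ^+ q).
  by exists q.
by rewrite leNgt exprSr gtr_pMr ?exprn_gt0// nu1.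
Qed.

Lemma near_norm_sub_le (R : realType) (V W : normedModType R) (f : V -> W)
    (a : V) (eps : R) :
  {for a, continuous f} -> 0 < eps -> \forall x \near a, `|f x - f a| <= eps.
Proof.
move=> /cvgrPdist_le fa /fa; apply: filterS => x.
by rewrite distrC.
Qed.

Lemma near_norm_sub_lt (R : realType) (V : normedModType R) (a : V) (eps : R) :
  0 < eps -> \forall x \near a, `|x - a| < eps.
Proof.
move=> eps0; apply/nbhs_ballP; exists eps => //= x.
by rewrite -ball_normE /= distrC.
Qed.

Lemma near_notin_closed (T U : topologicalType) (h : T -> U) (C : set U)
    (x : T) :
    {for x, continuous h} -> closed C -> ~ C (h x) ->
  \forall y \near x, ~ C (h y).
Proof.
move=> hx C_closed nC; have : nbhs (h x) (~` C).
  by apply: open_nbhs_nbhs; split=> //; rewrite openC.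
exact: hx.
Qed.

(** The type of a tuple depends on [omega] at its point; its set of values has a fixed type, so
    tuples chosen at different points can be compared. *)
Definition indices N p (a : {ffun 'I_N -> 'I_p}) : {set 'I_p} :=
  finset (mem (codom a)).

Lemma indicesP N p (a : {ffun 'I_N -> 'I_p}) i :
  reflect (exists j, i = a j) (i \in indices a).
Proof. by rewrite finset.in_set; apply: codomP. Qed.

Lemma mem_indices N p (a : {ffun 'I_N -> 'I_p}) j : a j \in indices a.
Proof. by apply/indicesP; exists j. Qed.

(** * Order properties of the cone and the Gerstewitz functional *)

Section Gerstewitz.
Context {R : realType} {m : nat} {K : set 'rV[R]_m} {e : 'rV[R]_m}.
Hypotheses (m_gt0 : (0 < m)%N) (K_cone : is_cone K) (K_closed : closed K).
Hypotheses (K_convex : convex_cone K) (K_pointed : pointed_cone K).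
Hypothesis e_int : interior K e.

Lemma coneZ (y : 'rV[R]_m) (t : R) : K y -> 0 <= t -> K (t *: y).
Proof. exact: K_cone.2. Qed.

Lemma cone0 : K 0.
Proof. by have [[y Ky] _] := K_cone; rewrite -(scale0r y); exact: coneZ. Qed.

Lemma coneD (y z : 'rV[R]_m) : K y -> K z -> K (y + z).
Proof. by move=> Ky Kz; rewrite -K_convex; exists y => //; exists z. Qed.

Lemma cone_anti (y : 'rV[R]_m) : K y -> K (- y) -> y = 0.
Proof.
move=> Ky Kny; have : (K `&` [set - z | z in K]) y.
  by split=> //; exists (- y) => //; rewrite opprK.
by rewrite K_pointed.
Qed.

Lemma cone_e_ball : exists2 r : R, 0 < r &
  forall y : 'rV[R]_m, `|y| <= r -> K (e - y).
Proof.
have [r /= r0 rK] := (nbhs_ballP _ _).1 e_int.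
exists (r / 2); first by rewrite divr_gt0.
move=> y yr; apply: rK; rewrite -ball_normE /= opprB addrC subrK.
by rewrite (le_lt_trans yr)// gtr_pMr// invf_lt1// ltr1n.
Qed.

Lemma cone_e : K e.
Proof. exact: nbhs_singleton e_int. Qed.

(** Pointedness would force [e = 0]; then a ball around 0 lies in [K], so a nonzero vector, which
    exists because [m > 0], lies in [K] together with its opposite. *)
Lemma cone_notNe : ~ K (- e).
Proof.
move=> Kne; have [r r0 rK] := cone_e_ball.
have e0 := cone_anti cone_e Kne.
pose z : 'rV[R]_m := const_mx r.
have zr : `|z| <= r.
  by apply: norm_le_coord => [|i j]; [exact: ltW | rewrite mxE gtr0_norm].
have Kz : K z.
  by rewrite -[z]opprK -[- - z]add0r -{1}e0; apply: rK; rewrite normrN.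
have Knz : K (- z) by rewrite -[- z]add0r -{1}e0; apply: rK.
have /matrixP/(_ ord0 (Ordinal m_gt0)) := cone_anti Kz Knz.
by rewrite !mxE => r00; rewrite r00 ltxx in r0.
Qed.

(* [r] is the radius of a ball around [e] inside [K]; beyond it [t e - y] and
   [s e + y] would both be in [K] with [s + t < 0], putting [- e] in [K]. *)
Lemma cone_scaleB_ge {r : R} {y : 'rV[R]_m} {t : R} : 0 < r ->
    (forall z : 'rV[R]_m, `|z| <= r -> K (e - z)) ->
  K (t *: e - y) -> - (`|y| / r) <= t.
Proof.
move=> r0 rK Kt; rewrite leNgt; apply/negP => tlt; apply: cone_notNe.
pose s : R := `|y| / r.
have Ks : K (s *: e + y).
  have [y0|y0] := eqVneq y 0.
    rewrite y0 addr0; apply: coneZ; first exact: cone_e.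
    by rewrite /s divr_ge0// ltW.
  have s0 : 0 < s by rewrite divr_gt0// normr_gt0.
  have -> : s *: e + y = s *: (e - - (s^-1 *: y)).
    by rewrite opprK scalerDr scalerA divff ?scale1r// gt_eqF.
  apply: coneZ (ltW s0); apply: rK; rewrite normrN normrZ gtr0_norm ?invr_gt0//.
  by rewrite /s invfM invrK mulrAC mulVf ?mul1r// normr_eq0.
have st0 : 0 < - (t + s) by rewrite oppr_gt0 -ltrBrDr sub0r.
have -> : - e = (- (t + s))^-1 *: ((t *: e - y) + (s *: e + y)).
  rewrite addrACA addNr addr0 -scalerDl scalerA invrN mulNr mulVf ?scaleN1r//.
  by rewrite -oppr_eq0 gt_eqF.
by apply: coneZ; [exact: coneD | rewrite invr_ge0 ltW].
Qed.

Lemma cone_scaleB {r : R} {y : 'rV[R]_m} : 0 < r ->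
    (forall z : 'rV[R]_m, `|z| <= r -> K (e - z)) ->
  K ((`|y| / r) *: e - y).
Proof.
move=> r0 rK; have [->|y0] := eqVneq y 0.
  by rewrite subr0; apply: coneZ; [exact: cone_e | rewrite divr_ge0// ltW].
have s0 : 0 < `|y| / r by rewrite divr_gt0// normr_gt0.
have -> : (`|y| / r) *: e - y = (`|y| / r) *: (e - (`|y| / r)^-1 *: y).
  by rewrite scalerBr scalerA divff ?scale1r// gt_eqF.
apply: coneZ (ltW s0); apply: rK; rewrite normrZ gtr0_norm ?invr_gt0//.
by rewrite invfM invrK mulrAC mulVf ?mul1r// normr_eq0.
Qed.

(** Admissible [t] exist and are bounded below thanks to the ball around [e], and closedness of [K]
    makes the infimum admissible. So the default value 0 of [minimum] never enters. *)
Lemma gerstewitz_minimum (y : 'rV[R]_m) :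
  is_minimum [set t | [set y + k | k in K] (t *: e)] (gerstewitz K e y).
Proof.
rewrite /gerstewitz /minimum; set A := (X in is_minimum X).
have AE t : A t <-> K (t *: e - y).
  split=> [[k Kk <-]|Kt]; first by rewrite addrC addKr.
  by exists (t *: e - y) => //; rewrite addrC subrK.
have [r r0 rK] := cone_e_ball.
have Ane : A !=set0 by exists (`|y| / r); apply/AE; exact: cone_scaleB.
have Alb : has_lbound A.
  by exists (- (`|y| / r)) => t /AE; exact: cone_scaleB_ge.
apply: (@xgetPex _ 0 [set t | is_minimum A t]); exists (inf A).
split; last by move=> t At; exact: ge_inf.
apply/AE; apply: (closed_approx K_closed) => d d0.
have e1 : 0 < `|e| + 1 by rewrite ltr_wpDl.
have [t At tlt] := inf_adherent (divr_gt0 d0 e1) (conj Ane Alb).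
exists (t *: e - y); first exact/AE.
rewrite opprB addrA subrK -scalerBl normrZ distrC.
have inft : inf A <= t by exact: ge_inf.
rewrite ger0_norm ?subr_ge0//.
rewrite (@le_lt_trans _ _ ((t - inf A) * (`|e| + 1)))//.
  by rewrite ler_wpM2l ?subr_ge0// lerDl.
by rewrite -ltr_pdivlMr// ltrBlDl.
Qed.

(** Admissibility is upward closed in [t] since [e] lies in [K]. In this form subadditivity, the
    scaling bound and monotonicity reduce to cone arithmetic. *)
Lemma gerstewitz_le (y : 'rV[R]_m) (t : R) :
  gerstewitz K e y <= t <-> K (t *: e - y).
Proof.
have [[k Kk yk] lb] := gerstewitz_minimum y; split=> [yt|Kt].
  have -> : t *: e - y = k + (t - gerstewitz K e y) *: e.
    by rewrite scalerBl -yk; apply/matrixP => i j; rewrite !mxE; ring.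
  by apply: coneD => //; apply: coneZ; [exact: cone_e | rewrite subr_ge0].
by apply: lb; exists (t *: e - y) => //; rewrite addrC subrK.
Qed.

Lemma gerstewitzK (y : 'rV[R]_m) : K (gerstewitz K e y *: e - y).
Proof. exact/gerstewitz_le. Qed.

Lemma gerstewitz_le0 (y : 'rV[R]_m) : gerstewitz K e y <= 0 <-> K (- y).
Proof. by rewrite -[- y]add0r -(scale0r e); exact: gerstewitz_le. Qed.

Lemma gerstewitzD (y z : 'rV[R]_m) :
  gerstewitz K e (y + z) <= gerstewitz K e y + gerstewitz K e z.
Proof.
apply/gerstewitz_le; rewrite scalerDl opprD addrACA.
by apply: coneD; exact: gerstewitzK.
Qed.

Lemma gerstewitzZ_le (s : R) (y : 'rV[R]_m) : 0 <= s ->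
  gerstewitz K e (s *: y) <= s * gerstewitz K e y.
Proof.
move=> s0; apply/gerstewitz_le; rewrite -scalerA -scalerBr.
by apply: coneZ => //; exact: gerstewitzK.
Qed.

Lemma gerstewitz_mono (y z : 'rV[R]_m) :
  K (z - y) -> gerstewitz K e y <= gerstewitz K e z.
Proof.
move=> yz; apply/gerstewitz_le; rewrite -(subrK z (_ *: e)) -addrA.
by apply: coneD => //; exact: gerstewitzK.
Qed.

Lemma gerstewitz_bounded : exists2 C : R, 0 < C &
  forall y : 'rV[R]_m, `|gerstewitz K e y| <= C * `|y|.
Proof.
have [r r0 rK] := cone_e_ball; exists r^-1; first by rewrite invr_gt0.
move=> y; rewrite mulrC ler_norml (cone_scaleB_ge r0 rK (gerstewitzK y)) /=.
exact/gerstewitz_le/cone_scaleB.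
Qed.

Lemma gerstewitzNe : gerstewitz K e (- e) <= -1.
Proof. by apply/gerstewitz_le; rewrite scaleN1r opprK addNr; exact: cone0. Qed.

(* Gordan's alternative: were the point [(- e, .., - e)] in the closure of the
   convex cone [{(w A_j + k_j)_j | k_j in K}], some [w] would make every
   [w A_j] interior to [- K]. *)
Lemma gordan_alternative n N (A : 'I_N -> 'M[R]_(n, m)) :
    (forall w : 'rV[R]_n, exists j, 0 <= gerstewitz K e (w *m A j)) ->
  exists mu : 'I_N -> 'rV[R]_m,
    [/\ forall j, dual_cone K (mu j), exists j, mu j != 0 &
        \sum_j mu j *m (A j)^T = 0].
Proof.
move=> wA; have [C C0 psiC] := gerstewitz_bounded.
pose B (w : 'rV[R]_n) (k : 'I_N -> 'rV[R]_m) : 'M[R]_(N, m) :=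
  \matrix_(j < N) (w *m A j + k j).
pose D : set 'rV[R]_(N * m) :=
  [set z | exists w, exists2 k, (forall j, K (k j)) & z = mxvec (B w k)].
pose E : 'M[R]_(N, m) := \matrix_(j < N) (- e).
have [||||y|mu muD muE] :=
    @convex_cone_separation _ _ D (mxvec E) C^-1.
- exists 0, (fun=> 0) => [j|]; first exact: cone0.
  apply/esym/eqP; rewrite mxvec_eq0; apply/eqP/row_matrixP => j.
  by rewrite rowK mul0mx addr0 row0.
- move=> _ _ [w1 [k1 k1K ->]] [w2 [k2 k2K ->]].
  exists (w1 + w2), (fun j => k1 j + k2 j) => [j|]; first exact: coneD.
  rewrite -linearD; congr mxvec; apply/row_matrixP => j.
  by rewrite linearD /= !rowK mulmxDl addrACA.
- move=> _ t [w [k kK ->]] t0.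
  exists (t *: w), (fun j => t *: k j) => [j|]; first exact: coneZ.
  rewrite -linearZ; congr mxvec; apply/row_matrixP => j.
  by rewrite linearZ /= !rowK -scalemxAl scalerDr.
- by rewrite invr_gt0.
- move=> [w [k kK ->]]; rewrite leNgt; apply/negP => EB.
  have [j] := wA w; rewrite leNgt => /negP; apply.
  pose rho := - row j (E - B w k).
  have -> : w *m A j = rho + (- e) + - k j.
    by rewrite /rho linearB /= !rowK opprB opprK !addrK.
  (* The radius [C^-1] gives [rho] a value below 1, which the value at most -1 at [- e]
     outweighs. *)
  have psi_rho : gerstewitz K e rho < 1.
    rewrite (le_lt_trans (ler_norm _))// (le_lt_trans (psiC _))//.
    rewrite mulrC -ltr_pdivlMr// mul1r (le_lt_trans _ EB)// normrN -linearB.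
    exact: row_mxvec_norm_le.
  rewrite (le_lt_trans (gerstewitzD _ _))//.
  have kj : gerstewitz K e (- k j) <= 0 by apply/gerstewitz_le0; rewrite opprK.
  have := gerstewitzD rho (- e); have := gerstewitzNe; lra.
pose mu' j := row j (vec_mx mu).
have muB w k : (forall j, K (k j)) -> 0 <= \sum_j dot (mu' j) (w *m A j + k j).
  move=> kK; have := muD (mxvec (B w k)); rewrite dot_mxvec.
  under eq_bigr do rewrite rowK; apply.
  by exists w, k.
exists mu'; split.
(* Taking [w = 0] and a family supported at [j] isolates the [j]-th multiplier. *)
- move=> j y Ky.
  have := muB 0 (fun i => if i == j then y else 0).
  rewrite (bigD1 j)//= eqxx mul0mx add0r big1 ?addr0; last first.
    by move=> i /negPf ->; rewrite mul0mx addr0 dot0.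
  by apply=> i; case: eqP => // _; exact: cone0.
- apply: contrapT => mu0; move: muE; rewrite dot_mxvec big1 ?ltxx// => j _.
  rewrite -/(mu' j); have -> : mu' j = 0.
    by apply/eqP/negPn/negP => muj; apply: mu0; exists j.
  by rewrite dotC dot0.
(* The choice [w = - y] turns the nonnegative sum into [- dot y y]. *)
- set y := \sum_j _; apply/eqP/negPn/negP => /dot_gt0.
  rewrite ltNge => /negP; apply; rewrite -oppr_ge0 -dotN.
  have := muB (- y) (fun=> 0) (fun=> cone0).
  rewrite [X in _ -> _ <= X](_ : _ = \sum_j dot (mu' j) (- y *m A j + 0))//.
  rewrite dot_mulmx mulmx_suml summxE; apply: eq_bigr => j _.
  by rewrite addr0 dot_mulmx trmx_mul mulmxA.
Qed.

(** * Descent directions and lower bounds on accepted steps *)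

Lemma gerstewitz_lipschitz (C : R) (y z : 'rV[R]_m) :
    (forall y, `|gerstewitz K e y| <= C * `|y|) ->
  gerstewitz K e y <= gerstewitz K e z + C * `|y - z|.
Proof.
move=> psiC; have -> : y = z + (y - z) by rewrite addrCA subrr addr0.
rewrite (le_trans (gerstewitzD _ _))// lerD2l addrAC subrr add0r.
exact: le_trans (ler_norm _) (psiC _).
Qed.

(** Shrinking [w] by [s] scales the negative term by [s] but the quadratic one by [s ^+ 2], so the
    former dominates for small [s]. *)
Lemma scaled_descent n I (A : {set I}) (G : I -> 'M[R]_(n, m)) (w : 'rV[R]_n) :
    (forall i, i \in A -> gerstewitz K e (w *m G i) < 0) ->
  exists (w0 : 'rV[R]_n) (delta : R), 0 < delta /\ forall i, i \in A ->
    gerstewitz K e (w0 *m G i) + 2^-1 * enorm w0 ^+ 2 <= - (2 * delta).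
Proof.
move=> /finite_negative_bound[eta eta0 wA].
pose q := enorm w ^+ 2; have q0 : 0 <= q by exact: sqr_ge0.
(* This gives [s * q <= eta], so the quadratic term uses up at most half of [s * eta]. *)
pose s := eta / (q + 1).
have q1 : 0 < q + 1 by rewrite ltr_wpDl.
have s0 : 0 < s by rewrite divr_gt0.
exists (s *: w), (s * eta / 4); split=> [|i iA].
  by rewrite divr_gt0// mulr_gt0.
rewrite -scalemxAl enorm2Z -/q.
have sq : s * q <= eta.
  by rewrite /s mulrAC ler_pdivrMr// ler_wpM2l ?ltW// ltrDl.
have h1 : gerstewitz K e (s *: (w *m G i)) <= s * - eta.
  rewrite (le_trans (gerstewitzZ_le _ (ltW s0)))//.
  by apply: ler_wpM2l; [exact: ltW | exact: wA].
have h2 : s ^+ 2 * q <= s * eta by rewrite expr2 -mulrA ler_pM2l.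
lra.
Qed.

(** The actual increment minus the allowed one is [s * (1 - beta)] times [u *m G], plus the
    remainder of the expansion. The scalarization of the first is at most
    [- s * (1 - beta) * delta], which absorbs that of the second. *)
Lemma sufficient_decrease_of_descent n (g : 'rV[R]_n -> 'rV[R]_m)
    (G : 'M[R]_(n, m)) (x u : 'rV[R]_n) (C beta delta eps s : R) :
    (forall y, `|gerstewitz K e y| <= C * `|y|) -> 0 < C -> beta < 1 ->
    0 <= s -> gerstewitz K e (u *m G) <= - delta ->
    `|g (x + s *: u) - g x - (s *: u) *m G| <= eps * `|s *: u| ->
    C * (eps * `|u|) <= (1 - beta) * delta ->
  cone_le K (g (x + s *: u)) (g x + (beta * s) *: (u *m G)).
Proof.
move=> psiC C0 beta1 s0 psi_u rem small.
pose rho : 'rV[R]_m := g (x + s *: u) - g x - (s *: u) *m G.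
have E : g (x + s *: u) - (g x + (beta * s) *: (u *m G)) =
    (s * (1 - beta)) *: (u *m G) + rho.
  rewrite /rho -scalemxAl; move: (u *m G) (g x) (g _) => d y z.
  have -> : s * (1 - beta) = s - beta * s by ring.
  by rewrite scalerBl [RHS]addrC addrA subrK opprD addrA.
rewrite /cone_le -opprB E; apply/gerstewitz_le0.
have sb : 0 <= s * (1 - beta) by rewrite mulr_ge0// subr_ge0 ltW.
rewrite (le_trans (gerstewitzD _ _))//.
have h1 : gerstewitz K e ((s * (1 - beta)) *: (u *m G)) <=
    s * (1 - beta) * - delta.
  by rewrite (le_trans (gerstewitzZ_le _ sb))// ler_wpM2l.
have h2 : gerstewitz K e rho <= s * ((1 - beta) * delta).
  rewrite (le_trans (ler_norm _))// (le_trans (psiC _))//.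
  rewrite (le_trans (ler_wpM2l (ltW C0) rem))// normrZ ger0_norm//.
  have -> : C * (eps * (s * `|u|)) = s * (C * (eps * `|u|)) by ring.
  by rewrite ler_wpM2l.
lra.
Qed.

(** Optimality of [u] for a fixed tuple, expressed through its index set alone: [B] stands for any
    bound on the maximum at a competitor [u']. *)
Definition direction_on n p (f : 'I_p -> 'rV[R]_n -> 'rV[R]_m)
    (A : {set 'I_p}) (x u : 'rV[R]_n) :=
  forall u' B,
    (forall i, i \in A -> gerstewitz K e (u' *m 'J (f i) x) <= B) ->
    forall i, i \in A -> gerstewitz K e (u *m 'J (f i) x)
      + 2^-1 * enorm u ^+ 2 <= B + 2^-1 * enorm u' ^+ 2.

Definition decrease_on n p (f : 'I_p -> 'rV[R]_n -> 'rV[R]_m)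
    (A : {set 'I_p}) (beta : R) (x u : 'rV[R]_n) (s : R) :=
  forall i, i \in A -> cone_le K (f i (x + s *: u))
    (f i x + (beta * s) *: (u *m 'J (f i) x)).

(* The common descent direction keeps [u] away from 0, and failure of the test
   at [t / nu] for a small [t] would contradict strict differentiability. *)
Lemma step_lower_bound n p (f : 'I_p -> 'rV[R]_n -> 'rV[R]_m)
    (A : {set 'I_p}) (xbar w : 'rV[R]_n) (beta nu : R) :
    (forall i, continuously_differentiable (f i)) ->
    beta < 1 -> 0 < nu -> nu < 1 -> A != finset.set0 ->
    (forall i, i \in A -> gerstewitz K e (w *m 'J (f i) xbar) < 0) ->
  exists2 eps : R, 0 < eps & \forall x \near xbar, forall u t,
    direction_on f A x u ->
    is_maximum [set nu ^+ q | q in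
      [set q | decrease_on f A beta x u (nu ^+ q)]] t ->
    eps <= t * enorm u ^+ 2.
Proof.
move=> f_C1 beta1 nu0 nu1 /finset.set0Pn[i0 i0A].
move=> /scaled_descent[w0 [delta [delta0 w0A]]].
have [C C0 psiC] := gerstewitz_bounded.
pose Jb : R := \sum_i `|'J (f i) xbar| + 1.
have Jb0 : 0 < Jb by rewrite ltr_wpDl// sumr_ge0.
(* Near [xbar] the scalarized derivative along [u] has absolute value at most [L * |u|]. *)
pose L : R := C * (n%:R * Jb) + 1.
have L0 : 0 < L by rewrite ltr_wpDl// !mulr_ge0// ltW.
(* Jacobians this close to those at [xbar] are bounded by [Jb] and change the scalarized derivative
   along [w0] by at most [delta]. *)
pose eps1 : R := Num.min 1 (delta / (C * (n%:R * `|w0|) + 1)).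
have D0 : 0 < C * (n%:R * `|w0|) + 1 by rewrite ltr_wpDl// !mulr_ge0// ltW.
have eps10 : 0 < eps1 by rewrite lt_min ltr01 divr_gt0.
(* Chosen so that [C * (eps2 * (2 * L))] equals [(1 - beta) * delta], where [2 * L] will bound
   [|u|]. *)
pose eps2 : R := (1 - beta) * delta / (2 * L * C).
have beta0 : 0 < 1 - beta by rewrite subr_gt0.
have eps20 : 0 < eps2 by rewrite divr_gt0// !mulr_gt0.
have [rho rho0 f_rho] : exists2 rho : R, 0 < rho & forall i (x d : 'rV[R]_n),
    `|x - xbar| < rho -> `|x + d - xbar| < rho ->
    `|f i (x + d) - f i x - d *m 'J (f i) x| <= eps2 * `|d|.
  apply: (@finite_radius R 'I_p (fun i r => forall x d : 'rV[R]_n,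
      `|x - xbar| < r -> `|x + d - xbar| < r -> _)).
    by move=> i r r' r'r P x d xr xdr; apply: P; apply: lt_le_trans r'r.
  by move=> i; exact: continuously_differentiable_strict.
(* If [t < tau], the rejected step [t / nu] moves [x] by less than [rho / 2]; the 1 accounts for a
   full step. *)
pose tau := Num.min 1 (nu * (rho / (4 * L))).
have tau0 : 0 < tau by rewrite lt_min ltr01 mulr_gt0// divr_gt0// mulr_gt0.
exists (tau * (delta / L) ^+ 2); first by rewrite mulr_gt0// exprn_gt0// divr_gt0.
have Jnear : \forall x \near xbar, forall i,
    `|'J (f i) x - 'J (f i) xbar| <= eps1.
  apply: (@filter_forall _ _ _ _ (nbhs_filter (xbar : 'rV[R]_n))) => i.
  exact: near_norm_sub_le ((f_C1 i).2 xbar) eps10.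
have xnear : \forall x \near xbar, `|x - xbar| < rho / 2.
  by apply: near_norm_sub_lt; rewrite divr_gt0.
near=> x => u t u_min t_max.
have Jx i : `|'J (f i) x - 'J (f i) xbar| <= eps1 by move: i; near: x.
have xrho : `|x - xbar| < rho / 2 by near: x.
have Jxb i : `|'J (f i) x| <= Jb.
  rewrite -(subrK ('J (f i) xbar) ('J (f i) x)) (le_trans (ler_normD _ _))//.
  rewrite addrC lerD//; last by rewrite (le_trans (Jx i))// ge_min lexx.
  by rewrite (bigD1 i)//= lerDl sumr_ge0.
have psi_le i : `|gerstewitz K e (u *m 'J (f i) x)| <= L * `|u|.
  rewrite (le_trans (psiC _))// (@le_trans _ _ (C * (n%:R * Jb) * `|u|))//.
    rewrite -mulrA ler_pM2l// (le_trans (norm_mulmx_le _ _))//.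
    by rewrite mulrAC ler_wpM2r// ler_wpM2l.
  by rewrite ler_wpM2r// lerDl.
have psi_u i : i \in A ->
    gerstewitz K e (u *m 'J (f i) x) + 2^-1 * enorm u ^+ 2 <= - delta.
  (* The competitor [w0] with this [B] makes the right-hand side exactly [- delta]. *)
  move=> iA; have := u_min w0 (- delta - 2^-1 * enorm w0 ^+ 2).
  rewrite subrK; apply=> // {i iA}i iA.
  rewrite (le_trans (gerstewitz_lipschitz _ (w0 *m 'J (f i) xbar) psiC))//.
  have h1 : C * `|w0 *m 'J (f i) x - w0 *m 'J (f i) xbar| <= delta.
    rewrite -mulmxBr.
    apply: (@le_trans _ _ (C * (n%:R * `|w0| * eps1))).
      rewrite ler_pM2l// (le_trans (norm_mulmx_le _ _))//.
      by apply: ler_wpM2l; [rewrite mulr_ge0 | exact: Jx].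
    apply: (@le_trans _ _ ((C * (n%:R * `|w0|) + 1) * eps1)).
      by rewrite mulrA ler_wpM2r ?(ltW eps10)// lerDl.
    by rewrite mulrC -ler_pdivlMr// ge_min lexx orbT.
  have := w0A i iA; lra.
have u2 := norm2_le_enorm2 u.
have u_lb : delta <= L * `|u|.
  have := psi_u i0 i0A; have := psi_le i0; rewrite ler_norml => /andP[h _].
  have : 0 <= enorm u ^+ 2 by exact: sqr_ge0.
  lra.
have u0 : 0 < `|u| by rewrite -(pmulr_rgt0 _ L0) (lt_le_trans delta0).
have u_ub : `|u| <= 2 * L.
  have := psi_u i0 i0A; have := psi_le i0; rewrite ler_norml => /andP[h _] h'.
  by rewrite -(ler_pM2r u0) -expr2; lra.
have {}u_lb : delta / L <= `|u| by rewrite ler_pdivrMr// mulrC.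
suff t_lb : tau <= t.
  apply: ler_pM => //; [exact: ltW | by rewrite exprn_ge0// divr_ge0// ltW |].
  rewrite (le_trans _ u2)// lerXn2r// nnegrE ?normr_ge0// divr_ge0// ltW//.
have [_ [->|[t0 nPt]]] := backtracking_fails nu0 nu1 t_max.
  by rewrite ge_min lexx.
rewrite leNgt; apply/negP => ttau; apply: nPt => i iA.
set s := t / nu; have s0 : 0 < s by rewrite divr_gt0.
have s_lt : s < rho / (4 * L).
  by rewrite ltr_pdivrMr// mulrC (lt_le_trans ttau)// ge_min lexx orbT.
have su : `|s *: u| < rho / 2.
  rewrite normrZ gtr0_norm// (le_lt_trans (ler_wpM2l (ltW s0) u_ub))//.
  rewrite (_ : rho / 2 = rho / (4 * L) * (2 * L)) ?ltr_pM2r ?mulr_gt0//.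
  by field; rewrite gt_eqF.
apply: (@sufficient_decrease_of_descent _ _ _ _ _ C beta delta eps2) => //.
- exact: ltW.
- by have := psi_u i iA; have : 0 <= enorm u ^+ 2 by [exact: sqr_ge0]; lra.
- apply: f_rho; first by rewrite (lt_trans xrho)// ltr_pdivrMr// ltr_pMr// ltr1n.
  rewrite addrAC (le_lt_trans (ler_normD _ _))//.
  by rewrite [ltRHS]splitr ltrD.
- apply: (@le_trans _ _ (C * (eps2 * (2 * L)))).
    by rewrite ler_pM2l// ler_pM2l.
  rewrite le_eqVlt; apply/orP; left; apply/eqP; rewrite /eps2; field.
  by rewrite !gt_eqF.
Unshelve. all: by end_near. Qed.

(** * Minimal elements and partition sets *)

Lemma MinP (A : set 'rV[R]_m) (y : 'rV[R]_m) :
  Min A K y <-> A y /\ forall z, A z -> K (y - z) -> z = y.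
Proof.
split=> -[Ay yA]; split=> //.
  move=> z Az Kyz; have : ([set y - k | k in K] `&` A) z.
    by split=> //; exists (y - z) => //; rewrite opprB addrC subrK.
  by rewrite yA.
apply/seteqP; split=> z /=.
  by move=> [[k Kk <-]] Ayk; apply: yA => //; rewrite opprB addrC subrK.
by move=> ->; split=> //; exists 0; [exact: cone0 | rewrite subr0].
Qed.

Section Iteration.
Context {n p : nat} {f : 'I_p -> 'rV[R]_n -> 'rV[R]_m}.
Variable v : forall x : 'rV[R]_n, 'I_(omega K f x) -> 'rV[R]_m.
Hypothesis v_enum : is_enumeration v.

(** Among the indices below [i], take one with the fewest indices below it; a value strictly under
    it would have fewer still, by transitivity and antisymmetry of the order. *)
Lemma Min_dominates x i :
  exists2 i', Min (setF f x) K (f i' x) & K (f i x - f i' x).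
Proof.
pose below i := finset (fun l => `[< K (f i x - f l x) >]).
have below_refl l : l \in below l.
  by rewrite finset.in_set subrr; apply/asboolP; exact: cone0.
case: (@arg_minnP _ i (fun l => l \in below i) (fun l => #|below l|)
  (below_refl i)) => i'.
rewrite /= finset.in_set => /asboolP Kii' i'min; exists i' => //; apply/MinP.
split=> [|_ [l _ <-] Kl]; first by exists i'.
apply: contrapT => li'.
have /i'min : l \in below i.
  rewrite finset.in_set; apply/asboolP; rewrite -(subrK (f i' x) (f i x)) -addrA.
  exact: coneD.
rewrite leqNgt => /negP; apply; apply: proper_card; apply/fintype.properP.
split; last first.
  exists i' => //; rewrite finset.in_set; apply/negP => /asboolP Ki'; apply: li'.
  by apply/eqP; rewrite -subr_eq0; apply/eqP/cone_anti => //; rewrite opprB.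
apply/fintype.subsetP => k; rewrite !finset.in_set => /asboolP Kk; apply/asboolP.
by rewrite -(subrK (f l x) (f i' x)) -addrA; exact: (coneD Kl Kk).
Qed.

Lemma partition_setP x (a : {ffun 'I_(omega K f x) -> 'I_p}) :
  reflect (forall j, f (a j) x = v j) (a \in partition_set v x).
Proof.
rewrite finset.in_set; apply: (iffP forallP) => av j; have := av j.
  by rewrite finset.in_set => /andP[_ /eqP].
move=> fav; rewrite !finset.in_set fav eqxx andbT; apply/asboolP.
by have [vMin _ _] := v_enum x; exact: (vMin j I).
Qed.

Lemma partition_dominates x (a : {ffun 'I_(omega K f x) -> 'I_p}) i :
  a \in partition_set v x -> exists j, K (f i x - f (a j) x).
Proof.
move=> /partition_setP av; have [i' Mi' Kii'] := Min_dominates x i.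
have [_ _ /(_ (f i' x) Mi')/=[j _ vj]] := v_enum x.
by exists j; rewrite av vj.
Qed.

Lemma near_not_le x i i' : (forall i, continuous (f i)) ->
    ~ K (f i x - f i' x) ->
  \forall y \near x, ~ K (f i y - f i' y).
Proof.
move=> cf nK.
have cfB : {for x, continuous (fun y => f i y - f i' y)}.
  by apply: continuousB; exact: cf.
exact: near_notin_closed cfB K_closed nK.
Qed.

(* Continuity and closedness of [K] make every minimal element at [xbar] the
   limit of one at [x]; as [omega] is locally constant, these exhaust the
   minimal elements at [x]. *)
Lemma near_partition xbar : (forall i, continuous (f i)) ->
    (\forall y \near xbar, omega K f y = omega K f xbar) ->
  \forall x \near xbar, forall a, a \in partition_set v x ->
    exists2 abar, abar \in partition_set v xbar &
      indices a = indices abar.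
Proof.
move=> cf omega_cst.
have K_near : \forall x \near xbar, forall ii' : 'I_p * 'I_p,
    K (f ii'.1 x - f ii'.2 x) -> K (f ii'.1 xbar - f ii'.2 xbar).
  apply: (@filter_forall _ _ _ _ (nbhs_filter (xbar : 'rV[R]_n))) => -[i i'] /=.
  have [Kii'|nK] := pselect (K (f i xbar - f i' xbar)).
    by apply: nearW.
  by apply: filterS (near_not_le cf nK).
near=> x => a aP.
have Kx ii' : K (f ii'.1 x - f ii'.2 x) -> K (f ii'.1 xbar - f ii'.2 xbar).
  by move: ii'; near: x.
have omega_x : omega K f x = omega K f xbar by near: x.
(* At [x], the function realizing [v jb] at [xbar] is dominated by some [f (a j)]; this relation
   passes to [xbar], where minimality forces equality. *)
have /choice[sigma sigmaE] : forall jb : 'I_(omega K f xbar),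
    exists j : 'I_(omega K f x), f (a j) xbar = v jb.
  move=> jb; have [/(_ jb I) vjb _ _] := v_enum xbar.
  have [[i _ ivjb] vmin] := (MinP _ _).1 vjb.
  have [j Kj] := partition_dominates i aP; exists j.
  by apply: vmin; [exists (a j) | rewrite -ivjb; exact: (Kx (i, a j))].
have sigma_inj : injective sigma.
  move=> j1 j2 j12; have [_ /(_ j1 j2) + _] := v_enum xbar.
  by apply; rewrite ?inE// -!sigmaE j12.
(* Equal values of [omega] turn injectivity into bijectivity, so no index of [a] is lost. *)
have [tau sigmaK tauK] : bijective sigma.
  by apply: inj_card_bij => //; rewrite !card_ord omega_x.
exists [ffun jb => a (sigma jb)].
  by apply/partition_setP => jb; rewrite ffunE sigmaE.
apply/setP => i; apply/indicesP/indicesP => -[j ->].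
  by exists (tau j); rewrite ffunE tauK.
by exists (sigma j); rewrite ffunE.
Unshelve. all: by end_near. Qed.

(** * The run of the method near its cluster point *)

Lemma range_maximum N (h : 'I_N -> R) : (0 < N)%N ->
  is_maximum (range h) (maximum (range h)).
Proof.
move=> N0; apply: (@xgetPex _ 0 [set t | is_maximum (range h) t]).
case: (@arg_maxP _ _ _ (Ordinal N0) xpredT h isT) => j _ jmax.
by exists (h j); split=> [|_ [i _ <-]]; [exists j | exact: jmax].
Qed.

(** The argmin inequality is restricted to competitors with the same tuple; both maxima are attained
    because [omega] is positive. *)
Lemma argmin_direction x (a : {ffun 'I_(omega K f x) -> 'I_p}) u :
  (0 < omega K f x)%N -> descent_argmin v e a u ->
  direction_on f (indices a) x u.
Proof.
move=> omega0 [aP amin] u' B u'B _ /indicesP[j ->].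
have [_ maxu] := range_maximum
  (fun j => gerstewitz K e (u *m 'J (f (a j)) x)) omega0.
have [[j' _ maxu'] _] := range_maximum
  (fun j => gerstewitz K e (u' *m 'J (f (a j)) x)) omega0.
apply: le_trans (le_trans (amin a u' aP) _).
  by rewrite lerD2r; apply: maxu; exists j.
by rewrite lerD2r -maxu'; apply: u'B; exact: mem_indices.
Qed.

(** Comparison with the zero direction bounds the scalarized derivative by
    [- (2^-1 * enorm u ^+ 2)]; the acceptance test and subadditivity carry this over to the
    values. *)
Lemma step_scalar_decrease (A : {set 'I_p}) (beta s : R) x u i :
    0 <= beta -> 0 <= s -> direction_on f A x u ->
    decrease_on f A beta x u s -> i \in A ->
  gerstewitz K e (f i (x + s *: u)) <=
    gerstewitz K e (f i x) - beta / 2 * (s * enorm u ^+ 2).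
Proof.
move=> beta0 s0 u_dir u_dec iA.
have h1 : gerstewitz K e (u *m 'J (f i) x) <= - (2^-1 * enorm u ^+ 2).
  have enorm0 : enorm (0 : 'rV[R]_n) ^+ 2 = 0.
    by rewrite -(scale0r 0) enorm2Z expr0n mul0r.
  have := u_dir 0 0; rewrite enorm0 mulr0 addr0 => u_dir0.
  suff : gerstewitz K e (u *m 'J (f i) x) + 2^-1 * enorm u ^+ 2 <= 0 by lra.
  apply: u_dir0 iA => k _; rewrite mul0mx.
  by apply/gerstewitz_le0; rewrite oppr0; exact: cone0.
rewrite (le_trans (gerstewitz_mono (u_dec i iA)))//.
rewrite (le_trans (gerstewitzD _ _))// lerD2l.
have bs0 : 0 <= beta * s by exact: mulr_ge0.
rewrite (le_trans (gerstewitzZ_le _ bs0))// (le_trans (ler_wpM2l bs0 h1))//.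
by rewrite le_eqVlt; apply/orP; left; apply/eqP; field.
Qed.

(** By monotonicity and continuity the scalarization stays above its value at [xbar] along the run,
    so a visit close to [xbar] leaves little for the next step to lose. *)
Lemma cluster_small_step (beta : R) (x : nat -> 'rV[R]_n) (xbar : 'rV[R]_n)
    (a : forall k, {ffun 'I_(omega K f (x k)) -> 'I_p})
    (u : nat -> 'rV[R]_n) (t : nat -> R) (U : set 'rV[R]_n) (eps : R) :
    (0 < p)%N -> (forall i, continuous (f i)) -> 0 < beta ->
    (forall k, [/\ direction_on f (indices (a k)) (x k) (u k),
      decrease_on f (indices (a k)) beta (x k) (u k) (t k), 0 <= t k,
      x k.+1 = x k + t k *: u k & a k \in partition_set v (x k)]) ->
    cluster (x @ \oo) xbar -> nbhs xbar U -> 0 < eps ->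
  exists2 k, U (x k) & t k * enorm (u k) ^+ 2 < eps.
Proof.
move=> p0 cf beta0 steps xbar_acc Uxbar eps0.
have [C C0 psiC] := gerstewitz_bounded.
have /choice[g gP] : forall y, exists r : R,
    (forall i, r <= gerstewitz K e (f i y)) /\
    exists i, r = gerstewitz K e (f i y).
  move=> y.
  case: (@arg_minP _ _ _ (Ordinal p0) xpredT
    (fun i => gerstewitz K e (f i y)) isT).
  move=> i _ imin; exists (gerstewitz K e (f i y)).
  by split; [move=> j; exact: imin | exists i].
have g_near (d : R) : 0 < d ->
    \forall y \near xbar, g y <= g xbar + d /\ g xbar <= g y + d.
  move=> d0; have f_near : \forall y \near xbar, forall i,
      `|f i y - f i xbar| <= d / C.
    apply: (@filter_forall _ _ _ _ (nbhs_filter (xbar : 'rV[R]_n))) => i.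
    exact: near_norm_sub_le (cf i xbar) (divr_gt0 d0 C0).
  near=> y; have fy i : `|f i y - f i xbar| <= d / C by move: i; near: y.
  have Cfy i : C * `|f i y - f i xbar| <= d by rewrite mulrC -ler_pdivlMr.
  split.
    have [i ->] := (gP xbar).2; rewrite (le_trans ((gP y).1 i))//.
    by rewrite (le_trans (gerstewitz_lipschitz _ (f i xbar) psiC))// lerD2l.
  have [i ->] := (gP y).2; rewrite (le_trans ((gP xbar).1 i))//.
  by rewrite (le_trans (gerstewitz_lipschitz _ (f i y) psiC))// lerD2l distrC.
have g_decr k : g (x k.+1) <= g (x k) - beta / 2 * (t k * enorm (u k) ^+ 2).
  have [u_dir u_dec t0 -> aP] := steps k.
  (* The index attaining [g (x k)] may lie outside the tuple, but some [a k j] has a value below it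
     and undergoes the decrease. *)
  have [i ->] := (gP (x k)).2; have [j Kj] := partition_dominates i aP.
  rewrite (le_trans ((gP _).1 (a k j)))//.
  rewrite (le_trans (step_scalar_decrease (ltW beta0) t0 u_dir u_dec
    (mem_indices _ j)))//.
  by rewrite lerD2r; exact: gerstewitz_mono.
have g_mono k l : (k <= l)%N -> g (x l) <= g (x k).
  elim: l => [|l IHl]; first by rewrite leqn0 => /eqP ->.
  rewrite leq_eqVlt => /predU1P[->//|/IHl]; apply: le_trans.
  rewrite (le_trans (g_decr l))// gerBl mulr_ge0 ?divr_ge0 ?(ltW beta0)//.
  by rewrite mulr_ge0 ?sqr_ge0//; have [] := steps l.
have visit (V : set 'rV[R]_n) N : nbhs xbar V -> exists2 k, (N <= k)%N & V (x k).
  move=> Vxbar; have [|_ [[k /= Nk <-] Vk]] :=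
    xbar_acc (x @` [set k | (N <= k)%N]) V _ Vxbar.
    by exists N => // k Nk; exists k.
  by exists k.
have g_lb k : g xbar <= g (x k).
  apply/ler_addgt0Pr => d d0; have [l kl [_ gl]] := visit _ k (g_near d d0).
  by rewrite (le_trans gl)// lerD2r g_mono.
(* Half of [beta / 2 * eps], so that the final inequality is strict. *)
have d0 : 0 < beta / 4 * eps by rewrite mulr_gt0// divr_gt0.
have [k _ [Uk [gk _]]] := visit _ 0%N (filterI Uxbar (g_near _ d0)).
exists k => //; have := g_decr k; have := g_lb k.+1.
have b2 : 0 < beta / 2 by rewrite divr_gt0.
rewrite -(ltr_pM2l b2).
have : beta / 4 * eps < beta / 2 * eps.
  by rewrite ltr_pM2r// ltr_pM2l// ltf_pV2 ?posrE// ltr_nat.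
lra.
Unshelve. all: by end_near. Qed.

(** Were there a common descent direction for each tuple, the finitely many lower bounds on the
    steps would merge into one [eps] near [xbar], against [cluster_small_step]. *)
Lemma cluster_stationary_index (x0 : 'rV[R]_n) (beta nu : R)
    (x : nat -> 'rV[R]_n) (xbar : 'rV[R]_n) :
    (0 < p)%N -> (forall i, continuously_differentiable (f i)) ->
    0 < beta -> beta < 1 -> 0 < nu -> nu < 1 ->
    descent_sequence v e x0 beta nu x -> cluster (x @ \oo) xbar ->
    (\forall y \near xbar, omega K f y = omega K f xbar) ->
  exists2 a, a \in partition_set v xbar &
    forall w, exists j, 0 <= gerstewitz K e (w *m 'J (f (a j)) xbar).
Proof.
move=> p0 f_C1 beta0 beta1 nu0 nu1 [_ [a [u [t run]]]] xbar_acc omega_cst.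
have cf i : continuous (f i).
  by move=> y; apply: differentiable_continuous; exact: (f_C1 i).1.
have t_max k : is_maximum [set nu ^+ q | q in
    [set q | decrease_on f (indices (a k)) beta (x k) (u k) (nu ^+ q)]] (t k).
  have [_ _ + _] := run k; congr is_maximum; congr image.
  apply/seteqP; split=> q /= dec; first by move=> _ /indicesP[j ->]; exact: dec.
  by move=> j; apply: dec; exact: mem_indices.
have steps k : [/\ direction_on f (indices (a k)) (x k) (u k),
    decrease_on f (indices (a k)) beta (x k) (u k) (t k), 0 <= t k,
    x k.+1 = x k + t k *: u k & a k \in partition_set v (x k)].
  have [amin _ _ xk] := run k; have [[q /= dec tq] _] := t_max k.
  (* As [p > 0], domination yields a position [j] of the tuple, so [omega] is positive at the
     iterate. *)
  have [j _] := partition_dominates (Ordinal p0) amin.1.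
  split=> //; [|by rewrite -tq|by rewrite -tq exprn_ge0// ltW|exact: amin.1].
  by apply: argmin_direction amin; apply: leq_ltn_trans (ltn_ord j).
apply: contrapT => no_a.
have [eps eps0 step_near] : exists2 eps : R, 0 < eps &
    forall abar : {ffun 'I_(omega K f xbar) -> 'I_p}, \forall y \near xbar,
    abar \in partition_set v xbar -> forall w s,
    direction_on f (indices abar) y w ->
    is_maximum [set nu ^+ q | q in
      [set q | decrease_on f (indices abar) beta y w (nu ^+ q)]] s ->
    eps <= s * enorm w ^+ 2.
  apply: (@finite_radius R _ (fun abar r => \forall y \near xbar,
    abar \in partition_set v xbar -> forall w s,
    direction_on f (indices abar) y w ->
    is_maximum [set nu ^+ q | q in
      [set q | decrease_on f (indices abar) beta y w (nu ^+ q)]] s ->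
    r <= s * enorm w ^+ 2)).
    move=> abar r r' r'r; apply: filterS => y yP aP w s w_dir s_max.
    exact: le_trans r'r (yP aP w s w_dir s_max).
  move=> abar; have [aP|aP] := boolP (abar \in partition_set v xbar); last first.
    (* Off the partition set the implication is vacuous, so the radius 1 is arbitrary. *)
    by exists 1 => //; apply: filterS omega_cst.
  have [w wP] : exists w, forall j,
      gerstewitz K e (w *m 'J (f (abar j)) xbar) < 0.
    apply: contrapT => nw; apply: no_a; exists abar => // w.
    apply: contrapT => noj; apply: nw; exists w => j.
    by rewrite ltNge; apply/negP => wj; apply: noj; exists j.
  have [||eps eps0 epsP] := @step_lower_bound n p f (indices abar) xbar w
    beta nu f_C1 beta1 nu0 nu1.
  - have [j _] := partition_dominates (Ordinal p0) aP.
    by apply/finset.set0Pn; exists (abar j); exact: mem_indices.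
  - by move=> _ /indicesP[j ->].
  - by exists eps => //; apply: filterS epsP => y yP _; exact: yP.
have near_all : \forall y \near xbar,
    (forall b, b \in partition_set v y -> exists2 abar,
       abar \in partition_set v xbar & indices b = indices abar) /\
    forall abar : {ffun 'I_(omega K f xbar) -> 'I_p},
    abar \in partition_set v xbar -> forall w s,
    direction_on f (indices abar) y w ->
    is_maximum [set nu ^+ q | q in
      [set q | decrease_on f (indices abar) beta y w (nu ^+ q)]] s ->
    eps <= s * enorm w ^+ 2.
  apply: filterI; first exact: near_partition.
  exact: (@filter_forall _ _ _ _ (nbhs_filter (xbar : 'rV[R]_n))).
have [k [kP stepP]] :=
  cluster_small_step p0 cf beta0 steps xbar_acc near_all eps0.
have [u_dir _ _ _ aP] := steps k; have [abar abarP E] := kP _ aP.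
by apply/negP; rewrite -leNgt; apply: stepP abarP _ _ _ _; rewrite -E.
Qed.

End Iteration.

End Gerstewitz.

(** * From one critical tuple to stationarity of the cluster point *)

Unset Implicit Arguments.
Set Strict Implicit.

Theorem theorem4p10 (R : realType) (n m p : nat)
  (n_gt0 : (0 < n)%N) (m_gt0 : (0 < m)%N) (p_gt0 : (0 < p)%N)
  (K : set 'rV[R]_m)
  (K_cone : is_cone K) (K_closed : closed K) (K_convex : convex_cone K)
  (K_pointed : pointed_cone K) (K_solid : solid_cone K)
  (e : 'rV[R]_m) (e_int : interior K e)
  (f : 'I_p -> 'rV[R]_n -> 'rV[R]_m)
  (f_C1 : forall i, continuously_differentiable (f i))
  (v : forall x : 'rV[R]_n, 'I_(omega K f x) -> 'rV[R]_m)
  (v_enum : is_enumeration v)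
  (x0 : 'rV[R]_n) (beta nu : R)
  (beta_gt0 : 0 < beta) (beta_lt1 : beta < 1)
  (nu_gt0 : 0 < nu) (nu_lt1 : nu < 1)
  (x : nat -> 'rV[R]_n)
  (x_run : descent_sequence v e x0 beta nu x)
  (xbar : 'rV[R]_n)
  (xbar_acc : cluster (x @ \oo) xbar)
  (xbar_regular : regular K f xbar) :
  stationary v xbar /\
  (#|partition_set v xbar| = 1%N -> strongly_stationary v xbar).
Proof.
have [a aP a_crit] := cluster_stationary_index m_gt0 K_cone K_closed K_convex
  K_pointed e_int v_enum p_gt0 f_C1 beta_gt0 beta_lt1 nu_gt0 nu_lt1 x_run
  xbar_acc xbar_regular.2.
have [mu mu_crit] := gordan_alternative m_gt0 K_cone K_closed K_convex
  K_pointed e_int a_crit.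
(* A single tuple already forms an admissible [Q]; when the partition set has one element, this [Q]
   is all of it. *)
have sub_a : finset.set1 a \subset partition_set v xbar by rewrite finset.sub1set.
have stat_a : stationary_wrt v (finset.set1 a).
  split=> //; first by apply/finset.set0Pn; exists a; rewrite finset.set11.
  by move=> b /finset.set1P ->; exists mu.
split; first by exists (finset.set1 a).
move=> P1; rewrite /strongly_stationary.
suff <- : finset.set1 a = partition_set v xbar by [].
by apply/eqP; rewrite finset.eqEcard sub_a P1 finset.cards1.
Qed.
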